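(* Let $\gamma>0$ and $c:=\mathrm{diag}(E^TRE)\in\mathbb{R}^m$. Consider the primal optimization problem $$\text{(P)}\qquad \begin{array}{rl}\underset{G,\,x_+,\,x_-}{\text{minimize}} & \langle G^{-1},Q_p\rangle + (\gamma\mathbf{1}+c)^Tx_+ + (\gamma\mathbf{1}-c)^Tx_-\\[1mm] \text{subject to} & G-G_p-E\,\mathrm{diag}(x_+-x_-)\,E^T=0,\\ & G\succ0,\quad x_+\ge0,\quad x_-\ge0.\end{array}$$ The Lagrange dual of (P) is given by $$\text{(D)}\qquad \begin{array}{rl}\underset{Y}{\text{maximize}} & 2\,\mathrm{trace}\left(\left(Q_p^{1/2}\,Y\,Q_p^{1/2}\right)^{1/2}\right)-\langle Y,G_p\rangle\\[1mm] \text{subject to} & \left\|\mathrm{diag}\left(E^T(Y-R)E\right)\right\|_\infty\le\gamma,\\ & Y\succ0,\quad Y\mathbf{1}=\mathbf{1},\end{array}$$ where $Y=Y^T\in\mathbb{R}^{n\times n}$ is the dual variable associated with the equality constraint in (P). The duality gap is $$\eta = y_+^Tx_+ + y_-^Tx_- = \mathbf{1}^T\left(y_+\circ x_+ + y_-\circ x_-\right),$$ where $$y_+ = \gamma\mathbf{1}-\mathrm{diag}\left(E^T(Y-R)E\right)\ge0,\qquad y_- = \gamma\mathbf{1}+\mathrm{diag}\left(E^T(Y-R)E\right)\ge0$$ are the Lagrange multipliers associated with the elementwise inequality constraints $x_+\ge0$ and $x_-\ge0$ in (P).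
   Context: $\mathbf{1}$ denotes the vector of all ones (of the appropriate dimension). $L_p\in\mathbb{R}^{n\times n}$ is a symmetric matrix, the graph Laplacian of the plant network (which may be disconnected), with $L_p\mathbf{1}=0$. $E\in\mathbb{R}^{n\times m}$ is the incidence matrix of the controller graph: each column has one entry $1$, one entry $-1$, and all other entries $0$. $Q=Q^T\succeq 0$ and $R=R^T\succ 0$ are $n\times n$ state and control weights with $Q\mathbf{1}=0$ and $Q+\frac1n\mathbf{1}\mathbf{1}^T\succ 0$. Set $$G_p := L_p + \tfrac1n\mathbf{1}\mathbf{1}^T,\qquad Q_p := Q+\tfrac1n\mathbf{1}\mathbf{1}^T + L_p R L_p .$$ In (P), $G\in\mathbb{R}^{n\times n}$ is symmetric and represents the strengthened graph Laplacian of the closed-loop network; the Laplacian structure imposes $G\mathbf{1}=\mathbf{1}$. The variables $x_+,x_-\in\mathbb{R}^m$ are the two non-negative vectors whose difference $x=x_+-x_-$ is the vector of controller edge weights. The duality gap $\eta$ is the difference between the objective function of (P), evaluated at a primal feasible $(G,x_+,x_-)$, and the objective function of (D), evaluated at a dual feasible $Y$. $\langle A,B\rangle = \mathrm{trace}(A^TB)$. For a vector $x$, $\mathrm{diag}(x)$ is the diagonal matrix with $x$ on the diagonal; for a square matrix $A$, $\mathrm{diag}(A)$ is the vector of its diagonal entries. $\|\cdot\|_\infty$ is the maximum absolute value of the entries of a vector, $\circ$ is the elementwise product, vector inequalities are elementwise, $A\succ0$ ($A\succeq0$) means symmetric positive definite (semidefinite), and $A^{1/2}$ is the positive semidefinite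 square root.
   Formalization: The formula for η fails for arbitrary primal/dual feasible pairs; the formal statement proves y₊ᵀx₊ + y₋ᵀx₋ ≤ η for all such pairs, with equality exactly when (G, x₊, x₋) minimizes the Lagrangian at the multipliers (Y, y₊, y₋). *)

(* Defs.v *)
(* MathComp / MathComp-Analysis *)
From mathcomp Require Import all_boot all_order all_algebra.
From mathcomp Require Import all_classical all_reals all_analysis.

Set Implicit Arguments.
Unset Strict Implicit.
Unset Printing Implicit Defensive.

Import Order.TTheory GRing.Theory Num.Theory.
Import numFieldNormedType.Exports.

Local Open Scope classical_set_scope.
Local Open Scope ring_scope.

Definition posdef (K : realType) (n : nat) (A : 'M[K]_n) : Prop :=
  A^T = A /\ forall v : 'cV[K]_n, v != 0 -> 0 < (v^T *m A *m v) 0 0.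

Definition possemidef (K : realType) (n : nat) (A : 'M[K]_n) : Prop :=
  A^T = A /\ forall v : 'cV[K]_n, 0 <= (v^T *m A *m v) 0 0.

(* For a positive semidefinite A the set below is a singleton; the default
   value 0 is only used for other arguments. *)
Definition psd_sqrt (K : realType) (n : nat) (A : 'M[K]_n) : 'M[K]_n :=
  xget 0 [set S : 'M[K]_n | possemidef S /\ S *m S = A].

Definition ones (K : realType) (n : nat) : 'cV[K]_n := const_mx 1.
Arguments ones {K n}.

Definition avg_mx (K : realType) (n : nat) : 'M[K]_n :=
  n%:R^-1 *: (ones *m ones^T).
Arguments avg_mx {K n}.

Definition dotv (K : realType) (m : nat) (x y : 'cV[K]_m) : K :=
  (x^T *m y) 0 0.

Definition dotm (K : realType) (n : nat) (A B : 'M[K]_n) : K :=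
  \tr (A^T *m B).

Definition diagv (K : realType) (m : nat) (A : 'M[K]_m) : 'cV[K]_m :=
  \col_i A i i.

Definition hadamard (K : realType) (m : nat) (x y : 'cV[K]_m) : 'cV[K]_m :=
  map2_mx *%R x y.

Definition nonneg_vec (K : realType) (m : nat) (x : 'cV[K]_m) : Prop :=
  forall i, 0 <= x i 0.

Definition is_incidence (K : realType) (n m : nat) (E : 'M[K]_(n, m)) : Prop :=
  forall j : 'I_m, exists i k : 'I_n,
    [/\ i != k, E i j = 1, E k j = -1 &
        forall l, l != i -> l != k -> E l j = 0].

Definition plant_G (K : realType) (n : nat) (Lp : 'M[K]_n) : 'M[K]_n :=
  Lp + avg_mx.

Definition plant_Q (K : realType) (n : nat) (Q R Lp : 'M[K]_n) : 'M[K]_n :=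
  Q + avg_mx + Lp *m R *m Lp.

(* Below, Gp, Qp and c stand for plant_G Lp, plant_Q Q R Lp and
   diagv (E^T *m R *m E). *)

Definition primal_obj (K : realType) (n m : nat) (Qp : 'M[K]_n)
    (c : 'cV[K]_m) (gamma : K) (G : 'M[K]_n) (xp xn : 'cV[K]_m) : K :=
  dotm (invmx G) Qp
  + dotv (gamma *: ones + c) xp + dotv (gamma *: ones - c) xn.

Definition primal_residual (K : realType) (n m : nat) (Gp : 'M[K]_n)
    (E : 'M[K]_(n, m)) (G : 'M[K]_n) (xp xn : 'cV[K]_m) : 'M[K]_n :=
  G - Gp - E *m diag_mx (xp - xn)^T *m E^T.

Definition primal_feasible (K : realType) (n m : nat) (Gp : 'M[K]_n)
    (E : 'M[K]_(n, m)) (G : 'M[K]_n) (xp xn : 'cV[K]_m) : Prop :=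
  [/\ primal_residual Gp E G xp xn = 0, posdef G,
      nonneg_vec xp & nonneg_vec xn].

(* Y is the multiplier of the equality constraint, yp and yn those of
   xp >= 0 and xn >= 0; G > 0 is kept as the domain of the problem. *)
Definition lagrangian (K : realType) (n m : nat) (Qp Gp : 'M[K]_n)
    (E : 'M[K]_(n, m)) (c : 'cV[K]_m) (gamma : K)
    (Y : 'M[K]_n) (yp yn : 'cV[K]_m) (G : 'M[K]_n) (xp xn : 'cV[K]_m) : K :=
  primal_obj Qp c gamma G xp xn + dotm Y (primal_residual Gp E G xp xn)
  - dotv yp xp - dotv yn xn.

Definition lagrangian_minimizer (K : realType) (n m : nat) (Qp Gp : 'M[K]_n)
    (E : 'M[K]_(n, m)) (c : 'cV[K]_m) (gamma : K)
    (Y : 'M[K]_n) (yp yn : 'cV[K]_m) (G : 'M[K]_n) (xp xn : 'cV[K]_m) : Prop :=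
  posdef G /\
  forall (G' : 'M[K]_n) (xp' xn' : 'cV[K]_m), posdef G' ->
    lagrangian Qp Gp E c gamma Y yp yn G xp xn
    <= lagrangian Qp Gp E c gamma Y yp yn G' xp' xn'.

Definition lagrange_dual_fun (K : realType) (n m : nat) (Qp Gp : 'M[K]_n)
    (E : 'M[K]_(n, m)) (c : 'cV[K]_m) (gamma : K)
    (Y : 'M[K]_n) (yp yn : 'cV[K]_m) : \bar K :=
  ereal_inf [set l : \bar K | exists (G : 'M[K]_n) (xp xn : 'cV[K]_m),
    posdef G /\ l = (lagrangian Qp Gp E c gamma Y yp yn G xp xn)%:E].

(* The Lagrange dual problem, before any simplification, is to maximize
   lagrange_dual_fun subject to multipliers_feasible. *)
Definition multipliers_feasible (K : realType) (n m : nat)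
    (Y : 'M[K]_n) (yp yn : 'cV[K]_m) : Prop :=
  [/\ Y^T = Y, nonneg_vec yp & nonneg_vec yn].

Definition lagrange_dual_value (K : realType) (n m : nat) (Qp Gp : 'M[K]_n)
    (E : 'M[K]_(n, m)) (c : 'cV[K]_m) (gamma : K) : \bar K :=
  ereal_sup [set l : \bar K | exists (Y : 'M[K]_n) (yp yn : 'cV[K]_m),
    multipliers_feasible Y yp yn
    /\ l = lagrange_dual_fun Qp Gp E c gamma Y yp yn].

Definition lagrange_dual_optimal (K : realType) (n m : nat) (Qp Gp : 'M[K]_n)
    (E : 'M[K]_(n, m)) (c : 'cV[K]_m) (gamma : K)
    (Y : 'M[K]_n) (yp yn : 'cV[K]_m) : Prop :=
  multipliers_feasible Y yp yn /\
  forall (Y' : 'M[K]_n) (yp' yn' : 'cV[K]_m), multipliers_feasible Y' yp' yn' ->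
    (lagrange_dual_fun Qp Gp E c gamma Y' yp' yn'
     <= lagrange_dual_fun Qp Gp E c gamma Y yp yn)%E.

Definition dual_obj (K : realType) (n : nat) (Qp Gp Y : 'M[K]_n) : K :=
  2 * \tr (psd_sqrt (psd_sqrt Qp *m Y *m psd_sqrt Qp)) - dotm Y Gp.

(* mx_norm is the largest absolute value of an entry. *)
Definition dual_feasible (K : realType) (n m : nat) (E : 'M[K]_(n, m))
    (R : 'M[K]_n) (gamma : K) (Y : 'M[K]_n) : Prop :=
  [/\ mx_norm (diagv (E^T *m (Y - R) *m E)) <= gamma,
      posdef Y & Y *m ones = ones].

Definition dual_value (K : realType) (n m : nat) (Qp Gp : 'M[K]_n)
    (E : 'M[K]_(n, m)) (R : 'M[K]_n) (gamma : K) : \bar K :=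
  ereal_sup [set l : \bar K | exists Y : 'M[K]_n,
    dual_feasible E R gamma Y /\ l = (dual_obj Qp Gp Y)%:E].

Definition dual_optimal (K : realType) (n m : nat) (Qp Gp : 'M[K]_n)
    (E : 'M[K]_(n, m)) (R : 'M[K]_n) (gamma : K) (Y : 'M[K]_n) : Prop :=
  dual_feasible E R gamma Y /\
  forall Y' : 'M[K]_n, dual_feasible E R gamma Y' ->
    dual_obj Qp Gp Y' <= dual_obj Qp Gp Y.

Definition ypos (K : realType) (n m : nat) (E : 'M[K]_(n, m))
    (R : 'M[K]_n) (gamma : K) (Y : 'M[K]_n) : 'cV[K]_m :=
  gamma *: ones - diagv (E^T *m (Y - R) *m E).

Definition yneg (K : realType) (n m : nat) (E : 'M[K]_(n, m))
    (R : 'M[K]_n) (gamma : K) (Y : 'M[K]_n) : 'cV[K]_m :=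
  gamma *: ones + diagv (E^T *m (Y - R) *m E).

Definition duality_gap (K : realType) (n m : nat) (Qp Gp : 'M[K]_n)
    (c : 'cV[K]_m) (gamma : K)
    (G : 'M[K]_n) (xp xn : 'cV[K]_m) (Y : 'M[K]_n) : K :=
  primal_obj Qp c gamma G xp xn - dual_obj Qp Gp Y.

(* Main.v *)
(* Once the multipliers of x+ and x- cancel the linear terms in x+ and x-, the
   Lagrangian is phi(Y,G) = <G^-1,Qp> + <Y,G-Gp>. If Y is positive definite and
   S, T are the square roots of Qp and SYS, then H = S T^-1 S solves the Riccati
   equation H Y H = Qp, and completing the square gives
   phi(Y,G) = phi(Y,H) + <Y, (H-G) G^-1 (H-G)>. So H is the unique minimizer, the
   minimum is the objective of (D), and G 1 = 1 at the minimizer iff Y 1 = 1. The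
   gap formula is the same identity at a primal feasible point.

   If phi(Y,.) is bounded below then Y is positive semidefinite; if moreover
   v^T Y v = 0 for some nonzero v, moving G along v v^T strictly decreases phi, so
   no minimizer exists. To compare the values of the two dual problems, perturb
   Y towards R, which makes it positive definite, and replace it by
   P Y P + 11^T/n, where P = I - 11^T/n; the latter preserves the edge
   constraints and does not decrease the dual function. *)
Require Import Defs.
From mathcomp Require Import all_boot all_order all_algebra.
From mathcomp Require Import all_classical all_reals all_analysis.
From mathcomp.real_closed Require Import complex.
From mathcomp Require Import ring lra.

Import Order.TTheory GRing.Theory Num.Theory.

Local Open Scope ring_scope.

(** * Existence of the positive semidefinite square root *)

(** Newton interpolation: the correction added for a new node [a] is a multiple of [r], which
    vanishes at all the other nodes. *)
Lemma poly_interpolation (F : fieldType) (f : F -> F) (s : seq F) :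
  exists p : {poly F}, forall x, x \in s -> p.[x] = f x.
Proof.
elim: s => [|a s [p IHp]]; first by exists 0.
case: (boolP (a \in s)) => [as_|ans].
  by exists p => x; rewrite inE => /orP[/eqP->|]; exact: IHp.
pose r := \prod_(y <- s) ('X - y%:P).
have ra0 : r.[a] != 0.
  by rewrite -/(root r a) /r root_prod_XsubC.
exists (p + ((f a - p.[a]) / r.[a]) *: r) => x.
rewrite inE hornerD hornerZ => /orP[/eqP->|xs].
  by rewrite divfK // addrC subrK.
have /eqP-> : root r x by rewrite /r root_prod_XsubC.
by rewrite mulr0 addr0 IHp.
Qed.

(** Transposition reverses products, but [A^T] commutes with its own polynomials. *)
Lemma trmx_horner_mx (F : fieldType) (n : nat) (A : 'M[F]_n.+1) (p : {poly F}) :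
  (horner_mx A p)^T = horner_mx A^T p.
Proof.
elim/poly_ind: p => [|p c IHp]; first by rewrite !rmorph0 trmx0.
rewrite !(rmorphD, rmorphM) /= !horner_mx_X !horner_mx_C linearD /= tr_scalar_mx.
rewrite trmx_mul IHp; congr (_ + _).
exact: comm_mx_horner.
Qed.

Lemma possemidef_eigenvalue_ge0 {K : realType} {n : nat} (A : 'M[K]_n) (a : K) :
  possemidef A -> eigenvalue A a -> 0 <= a.
Proof.
move=> [As Ap] /eigenvalueP[v vA vn0].
have := Ap v^T; rewrite trmxK vA -scalemxAl mxE => h.
have v2 : (v *m v^T) 0 0 = \sum_i v 0 i ^+ 2.
  by rewrite mxE; apply: eq_bigr => i _; rewrite mxE.
have : 0 < (v *m v^T) 0 0.
  have [i vi] : exists i, v 0 i != 0.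
    apply/existsP; move: vn0; apply: contraNT; rewrite negb_exists => /forallP h'.
    by apply/eqP/rowP => i; rewrite mxE; apply/eqP/negPn/h'.
  rewrite v2 (bigD1 i) //= ltr_wpDr ?sumr_ge0// => [j _|]; first exact: sqr_ge0.
  by rewrite exprn_even_gt0 //=.
by move=> v2p; move: h; rewrite pmulr_lge0.
Qed.

(* The root is q(A)^2, where q is a real polynomial interpolating the fourth
   root on the spectrum of A: this makes it real, symmetric and positive without
   any control of the complex diagonalizing matrix. *)
Lemma possemidef_sqrt_exists {K : realType} {n : nat} (A : 'M[K]_n) :
  possemidef A -> exists S, possemidef S /\ S *m S = A.
Proof.
case: n A => [|n] A Apsd.
  by exists A; split=> //; rewrite [LHS]thinmx0 [RHS]thinmx0.
have [As Ap] := Apsd.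
pose C : numClosedFieldType := complex K.
pose toC : {rmorphism K -> C} := real_complex K.
pose AC := map_mx toC A.
have ACh : AC \is hermsymmx.
  apply: realsym_hermsym.
    apply/is_hermitianmxP; rewrite expr0 scale1r map_mx_id //.
    by rewrite map_trmx As.
  by apply/mxOverP => i j; rewrite mxE; apply/complex_realP; exists (A i j).
have Punit := spectral_unit AC.
have ACE := orthomx_spectralP (hermitian_normalmx ACh).
have dreal := hermitian_spectral_diag_real ACh.
set P := spectralmx AC in Punit ACE.
set D := spectral_diag AC in ACE dreal.
pose d : 'rV[K]_n.+1 := \row_i complex.Re (D 0 i).
have DE i : D 0 i = toC (d 0 i).
  by rewrite mxE; apply/esym/RRe_real; move/mxOverP: dreal.
(* The rows of [P] are complex eigenvectors. Since [d 0 i] is real, being an eigenvalue descends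
   from the complexification to [A] itself, where positivity applies. *)
have d_ge0 i : 0 <= d 0 i.
  apply: (possemidef_eigenvalue_ge0 _ _ Apsd).
  rewrite -(eigenvalue_map toC) -/AC -DE; apply/eigenvalueP.
  exists (row i P); last first.
    apply/eqP => /(congr1 (mulmx^~ (invmx P))); rewrite rowE mulmxK // mul0mx.
    by move=> /rowP/(_ i)/eqP; rewrite !mxE !eqxx oner_eq0.
  rewrite {1}ACE -row_mul !mulmxA mulmxV // mul1mx.
  by rewrite row_mul row_diag_mx -scalemxAl -rowE.
have [q qd] := poly_interpolation _ (fun x => Num.sqrt (Num.sqrt x))
                 [seq d 0 i | i <- enum 'I_n.+1].
pose B := horner_mx A q.
have Bs : B^T = B by rewrite trmx_horner_mx As.
have B4 : B *m B *m (B *m B) = A.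
  have -> : B *m B *m (B *m B) = horner_mx A (q ^+ 4).
    by rewrite rmorphXn /= -/B exprSr exprSr exprSr expr1 -!mulmxE !mulmxA.
  apply: (@map_mx_inj _ _ toC).
  rewrite map_horner_mx -/AC {1}ACE horner_mx_uconjC // horner_mx_diag.
  rewrite [RHS]ACE; congr (_ *m diag_mx _ *m _).
  apply/rowP => i; rewrite mxE DE horner_map; congr (toC _).
  rewrite horner_exp qd; last by apply/mapP; exists i; rewrite ?mem_enum.
  by rewrite (exprM _ 2 2) sqr_sqrtr ?sqrtr_ge0 // sqr_sqrtr.
exists (B *m B); split=> //; split=> [|v]; first by rewrite trmx_mul Bs.
rewrite mulmxA -mulmxA -{1}Bs -trmx_mul mxE sumr_ge0 // => i _.
by rewrite mxE -expr2 sqr_ge0.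
Qed.

(** * Positive semidefinite matrices *)

(** Existence of a root makes the defining set nonempty, which excludes the default value of
    [psd_sqrt]. *)
Lemma psd_sqrtP {K : realType} {n : nat} {A : 'M[K]_n} :
  possemidef A -> possemidef (psd_sqrt A) /\ psd_sqrt A *m psd_sqrt A = A.
Proof.
move=> /possemidef_sqrt_exists[S SA]; rewrite /psd_sqrt; case: xgetP => //.
by move=> /(_ S).
Qed.

Lemma mulmx_trmx_sym {K : realType} {n p : nat} (A : 'M[K]_n) (M : 'M[K]_(n, p)) :
  A^T = A -> (M^T *m A *m M)^T = M^T *m A *m M.
Proof. by move=> As; rewrite !trmx_mul trmxK As mulmxA. Qed.

Lemma trmx_invmx_sym {K : realType} {n : nat} {A : 'M[K]_n} :
  A^T = A -> (invmx A)^T = invmx A.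
Proof. by move=> As; rewrite trmx_inv As. Qed.

Lemma dotvvE {K : realType} {m : nat} (x : 'cV[K]_m) :
  dotv x x = \sum_i x i 0 ^+ 2.
Proof. by rewrite /dotv mxE; apply: eq_bigr => i _; rewrite mxE. Qed.

Lemma dotvv_ge0 {K : realType} {m : nat} (x : 'cV[K]_m) : 0 <= dotv x x.
Proof. by rewrite dotvvE sumr_ge0 // => i _; exact: sqr_ge0. Qed.

Lemma dotvv_eq0 {K : realType} {m : nat} (x : 'cV[K]_m) :
  (dotv x x == 0) = (x == 0).
Proof.
apply/eqP/eqP => [|->]; last by rewrite /dotv mulmx0 mxE.
rewrite dotvvE => /psumr_eq0P x0; apply/colP => i; rewrite mxE.
by apply/eqP; rewrite -sqrf_eq0 x0 // => j _; exact: sqr_ge0.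
Qed.

Lemma dotvv_gt0 {K : realType} {m : nat} (x : 'cV[K]_m) :
  x != 0 -> 0 < dotv x x.
Proof. by move=> x0; rewrite lt_neqAle dotvv_ge0 eq_sym dotvv_eq0 x0. Qed.

Lemma dotvC {K : realType} {m : nat} (x y : 'cV[K]_m) : dotv x y = dotv y x.
Proof. by rewrite /dotv -{1}(trmxK y) -trmx_mul mxE. Qed.

Lemma cauchy_schwarz_dotv {K : realType} {m : nat} (x y : 'cV[K]_m) :
  dotv x y ^+ 2 <= dotv x x * dotv y y.
Proof.
have [->|y0] := eqVneq y 0.
  by rewrite /dotv !mulmx0 mxE expr0n mulr0.
(* Up to the factor [dotv y y], this vector is [x] minus its projection on [y]; its squared norm
   contains the Cauchy-Schwarz defect as a factor. *)
have := dotvv_ge0 (dotv y y *: x - dotv x y *: y).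
have -> : dotv (dotv y y *: x - dotv x y *: y) (dotv y y *: x - dotv x y *: y)
   = dotv y y * (dotv x x * dotv y y - dotv x y ^+ 2).
  rewrite {1}/dotv [(_ - _)^T]linearB /= ![(_ *: _)^T]linearZ /= mulmxBl.
  rewrite !mulmxBr -!scalemxAl -!scalemxAr.
  rewrite !mxE -/(dotv _ _).
  have e (u v : 'cV[K]_m) : \sum_j u^T 0 j * v j 0 = dotv u v.
    by rewrite /dotv mxE.
  rewrite !e (dotvC y x); ring.
by rewrite pmulr_rge0 ?dotvv_gt0 // subr_ge0.
Qed.

Lemma gram_possemidef {K : realType} {n p : nat} (M : 'M[K]_(p, n)) :
  possemidef (M^T *m M).
Proof.
split=> [|v]; first by rewrite trmx_mul trmxK.
by rewrite mulmxA -trmx_mul -mulmxA; exact: dotvv_ge0.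
Qed.

Lemma mxtrace_gramE {K : realType} {n p : nat} (M : 'M[K]_(p, n)) :
  \tr (M^T *m M) = \sum_i dotv (col i M) (col i M).
Proof.
apply: eq_bigr => i _; rewrite dotvvE mxE.
by apply: eq_bigr => j _; rewrite !mxE.
Qed.

Lemma mxtrace_gram_ge0 {K : realType} {n p : nat} (M : 'M[K]_(p, n)) :
  0 <= \tr (M^T *m M).
Proof. by rewrite mxtrace_gramE sumr_ge0 // => i _; exact: dotvv_ge0. Qed.

Lemma mxtrace_gram_eq0 {K : realType} {n p : nat} (M : 'M[K]_(p, n)) :
  \tr (M^T *m M) = 0 -> M = 0.
Proof.
rewrite mxtrace_gramE => /psumr_eq0P M0; apply/matrixP => i j.
have /eqP := M0 (fun i _ => dotvv_ge0 _) j isT.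
by rewrite dotvv_eq0 => /eqP/colP/(_ i); rewrite !mxE.
Qed.

Lemma possemidef_gram {K : realType} {n : nat} {A : 'M[K]_n} :
  possemidef A -> exists2 U : 'M[K]_n, U^T = U & A = U *m U.
Proof. by move=> /possemidef_sqrt_exists[U [[Us _] <-]]; exists U. Qed.

Lemma posdef_possemidef {K : realType} {n : nat} {A : 'M[K]_n} :
  posdef A -> possemidef A.
Proof.
move=> [As Ap]; split=> // v; have [->|v0] := eqVneq v 0.
  by rewrite mulmx0 mxE.
exact/ltW/Ap.
Qed.

Lemma posdef_unit {K : realType} {n : nat} {A : 'M[K]_n} :
  posdef A -> A \in unitmx.
Proof.
move=> [As Ap]; rewrite -row_free_unit -kermx_eq0.
apply/negPn/negP => /rowV0Pn[v /sub_kermxP vA v0].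
by have := Ap v^T; rewrite trmx_eq0 trmxK vA mul0mx mxE ltxx => /(_ v0).
Qed.

Lemma posdef_congruence {K : realType} {n : nat} (A M : 'M[K]_n) :
  posdef A -> M \in unitmx -> posdef (M^T *m A *m M).
Proof.
move=> [As Ap] Mu; split=> [|v v0]; first exact: mulmx_trmx_sym.
rewrite !mulmxA -trmx_mul -mulmxA; apply: Ap.
by apply: contra_neq v0 => Mv; rewrite -(mulKmx Mu v) Mv mulmx0.
Qed.

Lemma possemidef_congruence {K : realType} {n p : nat} (A : 'M[K]_n)
    (M : 'M[K]_(n, p)) :
  possemidef A -> possemidef (M^T *m A *m M).
Proof.
move=> [As Ap]; split=> [|v]; first exact: mulmx_trmx_sym.
by rewrite !mulmxA -trmx_mul -mulmxA; apply: Ap.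
Qed.

Lemma posdef1 {K : realType} {n : nat} : posdef (1%:M : 'M[K]_n).
Proof.
by split=> [|v v0]; [exact: trmx1 | rewrite mulmx1; exact: dotvv_gt0].
Qed.

Lemma possemidef_unit_posdef {K : realType} {n : nat} {A : 'M[K]_n} :
  possemidef A -> A \in unitmx -> posdef A.
Proof.
move=> /possemidef_gram[U Us ->]; rewrite unitmx_mul => /andP[Uu _].
by rewrite -{1}Us -(mulmx1 U^T); apply: posdef_congruence => //; exact: posdef1.
Qed.

Lemma posdef_inv {K : realType} {n : nat} {A : 'M[K]_n} :
  posdef A -> posdef (invmx A).
Proof.
move=> Apd; have Au := posdef_unit Apd.
have -> : invmx A = (invmx A)^T *m A *m invmx A.
  by rewrite (trmx_invmx_sym (proj1 Apd)) mulVmx // mul1mx.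
by apply: posdef_congruence => //; rewrite unitmx_inv.
Qed.

Lemma posdef_sqrt {K : realType} {n : nat} {A : 'M[K]_n} :
  posdef A -> posdef (psd_sqrt A).
Proof.
move=> Apd; have [Sp SA] := psd_sqrtP (posdef_possemidef Apd).
apply: possemidef_unit_posdef => //.
by have := posdef_unit Apd; rewrite -{1}SA unitmx_mul => /andP[].
Qed.

Lemma posdefDl {K : realType} {n : nat} {A B : 'M[K]_n} :
  posdef A -> possemidef B -> posdef (A + B).
Proof.
move=> [As Ap] [Bs Bp]; split=> [|v v0]; first by rewrite linearD /= As Bs.
by rewrite mulmxDr mulmxDl mxE ltr_wpDr // ?Ap.
Qed.

Lemma posdefZ {K : realType} {n : nat} {A : 'M[K]_n} {a : K} :
  0 < a -> posdef A -> posdef (a *: A).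
Proof.
move=> a0 [As Ap]; split=> [|v v0]; first by rewrite linearZ /= As.
by rewrite -scalemxAr -scalemxAl mxE mulr_gt0 // Ap.
Qed.

Lemma possemidefZ {K : realType} {n : nat} {A : 'M[K]_n} {a : K} :
  0 <= a -> possemidef A -> possemidef (a *: A).
Proof.
move=> a0 [As Ap]; split=> [|v]; first by rewrite linearZ /= As.
by rewrite -scalemxAr -scalemxAl mxE mulr_ge0 // Ap.
Qed.

(** With [A = U *m U] and [B = V *m V], cyclicity of the trace gives the squared Frobenius norm of
    [U *m V]. *)
Lemma mxtrace_mul_ge0 {K : realType} {n : nat} {A B : 'M[K]_n} :
  possemidef A -> possemidef B -> 0 <= \tr (A *m B).
Proof.
move=> /possemidef_gram[U Us ->] /possemidef_gram[V Vs ->].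
rewrite mxtrace_mulC -mulmxA mxtrace_mulC.
have -> : V *m (U *m U) *m V = (U *m V)^T *m (U *m V).
  by rewrite trmx_mul Us Vs !mulmxA.
exact: mxtrace_gram_ge0.
Qed.

Lemma mxtrace_rank1 {K : realType} {n : nat} (A : 'M[K]_n) (v : 'cV[K]_n) :
  \tr (A *m (v *m v^T)) = (v^T *m A *m v) 0 0.
Proof. by rewrite mulmxA mxtrace_mulC mulmxA /mxtrace big_ord1. Qed.

Lemma rank1_possemidef {K : realType} {n : nat} (v : 'cV[K]_n) :
  possemidef (v *m v^T).
Proof. by rewrite -{1}(trmxK v); exact: gram_possemidef. Qed.

(** By Cauchy-Schwarz, |v|^2 I - v v^T is positive semidefinite; pairing it with [A] gives the
    bound. Here the trace stands in for the largest eigenvalue. *)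
Lemma possemidef_quad_le_trace {K : realType} {n : nat} {A : 'M[K]_n}
    (v : 'cV[K]_n) :
  possemidef A -> (v^T *m A *m v) 0 0 <= \tr A * dotv v v.
Proof.
move=> Apsd.
have Vpsd : possemidef (dotv v v *: 1%:M - v *m v^T).
  split=> [|u].
    by rewrite linearB linearZ /= trmx1 trmx_mul trmxK.
  rewrite mulmxBr mulmxBl -scalemxAr -scalemxAl mulmx1.
  have -> : u^T *m (v *m v^T) *m u = dotv u v *: (v^T *m u).
    by rewrite mulmxA [u^T *m v]mx11_scalar -mul_scalar_mx mulmxA.
  rewrite !mxE subr_ge0 -/(dotv u u).
  have := cauchy_schwarz_dotv u v; rewrite mulrC expr2 (dotvC u v) /dotv.
  by rewrite !mxE.
have := mxtrace_mul_ge0 Apsd Vpsd.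
rewrite mulmxBr linearB /= mxtrace_rank1 -scalemxAr mulmx1 linearZ /=.
by rewrite subr_ge0 mulrC.
Qed.

(** The trace bound for [invmx A] at the vector [U *m v], where [A = U *m U], yields the constant 1
    / (1 + tr A^-1). The added 1 keeps it well defined in dimension 0. *)
Lemma posdef_coercive {K : realType} {n : nat} {A : 'M[K]_n} :
  posdef A -> exists2 a, 0 < a & forall v, a * dotv v v <= (v^T *m A *m v) 0 0.
Proof.
move=> Apd; have := posdef_unit Apd.
have [U Us AU] := possemidef_gram (posdef_possemidef Apd).
rewrite {1}AU unitmx_mul => /andP[Uu _].
pose t := 1 + \tr (invmx A).
have tA0 : 0 <= \tr (invmx A).
  rewrite -(mulmx1 (invmx A)); apply: mxtrace_mul_ge0.
    exact/posdef_possemidef/posdef_inv.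
  exact/posdef_possemidef/posdef1.
have t0 : 0 < t by rewrite ltr_pwDl.
exists t^-1; first by rewrite invr_gt0.
move=> v; rewrite mulrC ler_pdivrMr // mulrC.
have -> : (v^T *m A *m v) 0 0 = dotv (U *m v) (U *m v).
  by rewrite /dotv trmx_mul Us AU !mulmxA.
have -> : dotv v v = ((U *m v)^T *m invmx A *m (U *m v)) 0 0.
  have -> : (U *m v)^T *m invmx A *m (U *m v) = v^T *m (U *m invmx A *m U) *m v.
    by rewrite trmx_mul Us !mulmxA.
  have -> : U *m invmx A *m U = 1%:M.
    rewrite -[LHS](mulKmx Uu) !(mulmxA U) -AU mulmxV ?(posdef_unit Apd) //.
    by rewrite mul1mx mulVmx.
  by rewrite mulmx1.
apply: le_trans (possemidef_quad_le_trace _ _) _.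
  exact/posdef_possemidef/posdef_inv.
by rewrite ler_wpM2r ?dotvv_ge0 // lerDr.
Qed.

(** * Minimizing the reduced Lagrangian *)

(* What remains of the Lagrangian once the terms in x+ and x- cancel. *)
Definition reduced_lagrangian {K : realType} {n : nat}
    (Qp Gp Y G : 'M[K]_n) : K :=
  \tr (invmx G *m Qp) + \tr (Y *m (G - Gp)).

(** For positive definite arguments this is the matrix geometric mean of [Qp] and the inverse of
    [Y]. *)
Definition dual_argmin {K : realType} {n : nat} (Qp Y : 'M[K]_n) : 'M[K]_n :=
  let S := psd_sqrt Qp in S *m invmx (psd_sqrt (S *m Y *m S)) *m S.

Lemma posdef_sandwich {K : realType} {n : nat} {S Y : 'M[K]_n} :
  posdef S -> posdef Y -> posdef (S *m Y *m S).
Proof.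
move=> Spd Ypd; have := posdef_congruence _ _ Ypd (posdef_unit Spd).
by rewrite (proj1 Spd).
Qed.

Lemma posdef_dual_argmin {K : realType} {n : nat} {Qp Y : 'M[K]_n} :
  posdef Qp -> posdef Y -> posdef (dual_argmin Qp Y).
Proof.
move=> /posdef_sqrt Spd Ypd; apply: posdef_sandwich => //.
exact/posdef_inv/posdef_sqrt/posdef_sandwich.
Qed.

Lemma dual_argmin_riccati {K : realType} {n : nat} {Qp Y : 'M[K]_n} :
  posdef Qp -> posdef Y -> dual_argmin Qp Y *m Y *m dual_argmin Qp Y = Qp.
Proof.
move=> Qpd Ypd; rewrite /dual_argmin.
have [_ SS] := psd_sqrtP (posdef_possemidef Qpd).
have SYSpd := posdef_sandwich (posdef_sqrt Qpd) Ypd.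
have [_ TT] := psd_sqrtP (posdef_possemidef SYSpd).
have Tu := posdef_unit (posdef_sqrt SYSpd).
set S := psd_sqrt Qp in SS SYSpd TT Tu *.
set T := psd_sqrt (S *m Y *m S) in TT Tu *.
rewrite -!mulmxA (mulmxA Y) (mulmxA S (Y *m S)) (mulmxA S Y S) -TT.
by rewrite -mulmxA (mulmxA T (invmx T)) mulmxV // mul1mx mulKmx.
Qed.

Lemma mxtrace_dual_argmin {K : realType} {n : nat} {Qp Y : 'M[K]_n} :
  posdef Qp -> posdef Y ->
  \tr (Y *m dual_argmin Qp Y) = \tr (psd_sqrt (psd_sqrt Qp *m Y *m psd_sqrt Qp)).
Proof.
move=> Qpd Ypd; rewrite /dual_argmin.
have SYSpd := posdef_sandwich (posdef_sqrt Qpd) Ypd.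
have [_ TT] := psd_sqrtP (posdef_possemidef SYSpd).
have Tu := posdef_unit (posdef_sqrt SYSpd).
by rewrite mulmxA mxtrace_mulC !mulmxA -{1}TT mulmxK.
Qed.

Lemma reduced_lagrangian_riccati {K : realType} {n : nat}
    {Qp Gp Y G : 'M[K]_n} :
  G \in unitmx -> G *m Y *m G = Qp ->
  reduced_lagrangian Qp Gp Y G = 2 * \tr (Y *m G) - \tr (Y *m Gp).
Proof.
move=> Gu <-; rewrite /reduced_lagrangian -!mulmxA mulKmx // mulmxBr linearB /=.
ring.
Qed.

(** Cyclicity turns <G^-1, HYH> into <Y, H G^-1 H>, and (H-G) G^-1 (H-G) expands to H G^-1 H - 2H +
    G. *)
Lemma reduced_lagrangian_square {K : realType} {n : nat}
    {Qp Gp Y G : 'M[K]_n} (H : 'M[K]_n) :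
  G \in unitmx -> H \in unitmx -> H *m Y *m H = Qp ->
  reduced_lagrangian Qp Gp Y G = reduced_lagrangian Qp Gp Y H
    + \tr (Y *m ((H - G) *m invmx G *m (H - G))).
Proof.
move=> Gu Hu HYH; rewrite (reduced_lagrangian_riccati Hu HYH).
rewrite /reduced_lagrangian -HYH.
have -> : (H - G) *m invmx G *m (H - G) = H *m invmx G *m H - H - H + G.
  rewrite mulmxBl mulmxV // mulmxBl mul1mx mulmxBr -(mulmxA H (invmx G) G).
  by rewrite mulVmx // mulmx1 opprB addrA addrAC.
have -> : \tr (invmx G *m (H *m Y *m H)) = \tr (Y *m (H *m invmx G *m H)).
  by rewrite -!mulmxA (mulmxA (invmx G)) mxtrace_mulC !mulmxA.
rewrite !mulmxDr !mulmxN !linearD /= !linearN /=; ring.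
Qed.

Lemma mxtrace_weighted_square_ge0 {K : realType} {n : nat} {Y W D : 'M[K]_n} :
  posdef Y -> posdef W -> D^T = D -> 0 <= \tr (Y *m (D *m W *m D)).
Proof.
move=> Ypd Wpd Ds; apply: mxtrace_mul_ge0; first exact: posdef_possemidef.
by rewrite -{1}Ds; exact/possemidef_congruence/posdef_possemidef.
Qed.

(** With [Y = U *m U] and [W = V *m V], the trace is the squared Frobenius norm of [V *m D *m U],
    and [U], [V] are invertible. This is what makes the minimizer unique. *)
Lemma mxtrace_weighted_square_eq0 {K : realType} {n : nat} {Y W D : 'M[K]_n} :
  posdef Y -> posdef W -> D^T = D -> \tr (Y *m (D *m W *m D)) = 0 -> D = 0.
Proof.
move=> Ypd Wpd Ds.
have [U Us YU] := possemidef_gram (posdef_possemidef Ypd).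
have [V Vs WV] := possemidef_gram (posdef_possemidef Wpd).
have := posdef_unit Ypd; rewrite YU unitmx_mul => /andP[Uu _].
have := posdef_unit Wpd; rewrite WV unitmx_mul => /andP[Vu _].
have -> : \tr (U *m U *m (D *m (V *m V) *m D))
        = \tr ((V *m D *m U)^T *m (V *m D *m U)).
  by rewrite !trmx_mul Us Ds Vs -(mulmxA U U) mxtrace_mulC !mulmxA.
move/mxtrace_gram_eq0 => VDU.
by rewrite -(mulKmx Vu D) -(mulmxK Uu (V *m D)) VDU mul0mx mulmx0.
Qed.

Lemma reduced_lagrangian_argmin {K : realType} {n : nat} {Qp Gp Y : 'M[K]_n} :
  posdef Qp -> posdef Y ->
  reduced_lagrangian Qp Gp Y (dual_argmin Qp Y) = dual_obj Qp Gp Y.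
Proof.
move=> Qpd Ypd.
rewrite (reduced_lagrangian_riccati (posdef_unit (posdef_dual_argmin Qpd Ypd))).
  by rewrite mxtrace_dual_argmin // /dual_obj /dotm (proj1 Ypd).
exact: dual_argmin_riccati.
Qed.

Lemma dual_obj_le_reduced_lagrangian {K : realType} {n : nat}
    {Qp Gp Y G : 'M[K]_n} :
  posdef Qp -> posdef Y -> posdef G ->
  dual_obj Qp Gp Y <= reduced_lagrangian Qp Gp Y G.
Proof.
move=> Qpd Ypd Gpd; have Hpd := posdef_dual_argmin Qpd Ypd.
rewrite (reduced_lagrangian_square (dual_argmin Qp Y)) ?posdef_unit //.
  rewrite reduced_lagrangian_argmin // lerDl.
  apply: mxtrace_weighted_square_ge0 => //; first exact: posdef_inv.
  by rewrite linearB /= (proj1 Hpd) (proj1 Gpd).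
exact: dual_argmin_riccati.
Qed.

Lemma reduced_lagrangian_argmin_unique {K : realType} {n : nat}
    {Qp Gp Y G : 'M[K]_n} :
  posdef Qp -> posdef Y -> posdef G ->
  reduced_lagrangian Qp Gp Y G <= dual_obj Qp Gp Y -> G = dual_argmin Qp Y.
Proof.
move=> Qpd Ypd Gpd; have Hpd := posdef_dual_argmin Qpd Ypd.
rewrite (reduced_lagrangian_square (dual_argmin Qp Y)) ?posdef_unit //;
  last exact: dual_argmin_riccati.
have Ds : (dual_argmin Qp Y - G)^T = dual_argmin Qp Y - G.
  by rewrite linearB /= (proj1 Hpd) (proj1 Gpd).
rewrite reduced_lagrangian_argmin // gerDl => D0.
apply/esym/eqP; rewrite -subr_eq0; apply/eqP.
apply: (mxtrace_weighted_square_eq0 Ypd (posdef_inv Gpd) Ds).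
apply/eqP; rewrite eq_le D0.
exact: (mxtrace_weighted_square_ge0 Ypd (posdef_inv Gpd) Ds).
Qed.

(** * Rank-one perturbations of G *)

Lemma sherman_morrison {K : realType} {n : nat} {G : 'M[K]_n} {v : 'cV[K]_n}
    {s : K} (w := invmx G *m v) :
  posdef G -> 0 <= s ->
  invmx (G + s *: (v *m v^T)) = invmx G - (s / (1 + s * dotv v w)) *: (w *m w^T).
Proof.
move=> Gpd s0.
have vw0 : 0 <= dotv v w.
  by rewrite /dotv /w mulmxA; exact: (posdef_possemidef (posdef_inv Gpd)).2.
(* As [s] and [dotv v w] are nonnegative, the denominator is at least 1. *)
have d0 : 1 + s * dotv v w != 0 by rewrite gt_eqF // ltr_pwDl // mulr_ge0.
have Gu := posdef_unit Gpd.
have Hpd := posdefDl Gpd (possemidefZ s0 (rank1_possemidef v)).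
set c := s / _.
have GH : (G + s *: (v *m v^T)) *m (invmx G - c *: (w *m w^T)) = 1%:M.
  have wT : w^T = v^T *m invmx G.
    by rewrite /w trmx_mul (trmx_invmx_sym (proj1 Gpd)).
  rewrite mulmxBr !mulmxDl mulmxV // -scalemxAl -mulmxA -wT -!scalemxAr.
  rewrite (mulmxA G) /w mulKVmx // -/w -scalemxAl -mulmxA (mulmxA v^T w).
  rewrite [v^T *m w]mx11_scalar -/(dotv v w) mul_scalar_mx -scalemxAr.
  rewrite !scalerA -scalerDl -addrA -scalerBl -[RHS]addr0; congr (_ + _).
  rewrite -[RHS](scale0r (v *m w^T)); congr (_ *: _).
  by rewrite /c; field.
by rewrite -[RHS](mulKmx (posdef_unit Hpd)) GH mulmx1.
Qed.

Lemma reduced_lagrangian_rank1_update {K : realType} {n : nat}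
    {Qp Gp Y G : 'M[K]_n} {v : 'cV[K]_n} {s : K} (w := invmx G *m v) :
  posdef G -> 0 <= s ->
  reduced_lagrangian Qp Gp Y (G + s *: (v *m v^T))
  = reduced_lagrangian Qp Gp Y G + s * (v^T *m Y *m v) 0 0
    - s / (1 + s * dotv v w) * (w^T *m Qp *m w) 0 0.
Proof.
move=> Gpd s0; rewrite /reduced_lagrangian (sherman_morrison Gpd s0) -/w.
rewrite mulmxBl -scalemxAl [\tr (_ - _)]linearB /= mxtraceZ.
rewrite (mxtrace_mulC (w *m w^T)) mxtrace_rank1 -(mxtrace_rank1 Y).
rewrite (addrAC G) (mulmxDr Y) [\tr (_ *m _ + _)]linearD /= -scalemxAr mxtraceZ.
ring.
Qed.

(** Along I + s v v^T the [Qp] term does not increase, while the [Y] term changes by s v^T Y v; a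
    negative v^T Y v would drive the value below any bound. *)
Lemma reduced_lagrangian_bounded_possemidef {K : realType} {n : nat}
    {Qp Gp Y : 'M[K]_n} (l : K) :
  possemidef Qp -> Y^T = Y ->
  (forall G, posdef G -> l <= reduced_lagrangian Qp Gp Y G) -> possemidef Y.
Proof.
move=> Qpsd Ys lb; split=> // v; rewrite leNgt; apply/negP => y0.
set y := (v^T *m Y *m v) 0 0 in y0.
have I0 := @posdef1 K n.
pose r := reduced_lagrangian Qp Gp Y 1%:M.
have rl : l <= r by exact: lb.
(* Chosen so that [r + s * y = l - 1], which contradicts the lower bound [l]. *)
pose s := (r - l + 1) / (- y).
have s0 : 0 <= s by rewrite divr_ge0 ?oppr_ge0 ?(ltW y0) // addr_ge0 ?subr_ge0.
have := lb _ (posdefDl I0 (possemidefZ s0 (rank1_possemidef v))).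
rewrite reduced_lagrangian_rank1_update // -/y -/r => h.
have {h} : l <= r + s * y.
  apply: (le_trans h); rewrite gerDl oppr_le0 mulr_ge0 //; last exact: Qpsd.2.
  rewrite divr_ge0 // addr_ge0 // mulr_ge0 // invmx1 mul1mx; exact: dotvv_ge0.
have -> : s * y = - (r - l + 1).
  by rewrite /s; field; rewrite lt_eqF.
lra.
Qed.

(** Moving along v v^T costs nothing in the [Y] term. The step 1 / [dotv v w] makes the gain w^T Qp
    w / (2 v^T w), and v^T w = w^T G w is at most tr G |w|^2. The guaranteed decrease thus depends
    on [G] only through its trace. *)
Lemma reduced_lagrangian_null_descent {K : realType} {n : nat}
    {Qp Gp Y G : 'M[K]_n} {v : 'cV[K]_n} {q : K} :
  0 < q -> (forall w, q * dotv w w <= (w^T *m Qp *m w) 0 0) ->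
  v != 0 -> (v^T *m Y *m v) 0 0 = 0 -> posdef G ->
  exists2 G', posdef G' &
    reduced_lagrangian Qp Gp Y G'
    <= reduced_lagrangian Qp Gp Y G - q / (2 * \tr G).
Proof.
move=> q0 Qq v0 vYv Gpd; have Gu := posdef_unit Gpd.
pose w := invmx G *m v.
have w0 : w != 0.
  by apply: contra_neq v0; rewrite /w => w0; rewrite -(mulKVmx Gu v) w0 mulmx0.
have ww := dotvv_gt0 _ w0.
have vwE : dotv v w = (w^T *m G *m w) 0 0.
  by rewrite dotvC /dotv -{1}(mulKVmx Gu v) -/w mulmxA.
have vw0 : 0 < dotv v w by rewrite vwE; exact: Gpd.2.
have trG : dotv v w <= \tr G * dotv w w.
  by rewrite vwE; apply: possemidef_quad_le_trace; exact: posdef_possemidef.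
have tr0 : 0 < \tr G by have := lt_le_trans vw0 trG; rewrite pmulr_lgt0.
have s0 : 0 <= (dotv v w)^-1 by rewrite invr_ge0 ltW.
exists (G + (dotv v w)^-1 *: (v *m v^T)).
  exact: (posdefDl Gpd (possemidefZ s0 (rank1_possemidef v))).
rewrite reduced_lagrangian_rank1_update // vYv mulr0 addr0 -/w lerD2l lerN2.
rewrite mulVf ?gt_eqF // ler_pdivrMr; last by rewrite mulr_gt0.
have -> : (dotv v w)^-1 / (1 + 1) * (w^T *m Qp *m w) 0 0 * (2 * \tr G)
  = ((w^T *m Qp *m w) 0 0 * \tr G) / dotv v w.
  by field; rewrite gt_eqF.
rewrite ler_pdivlMr //; apply: (@le_trans _ _ (q * (\tr G * dotv w w))).
  by rewrite ler_pM2l.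
by rewrite mulrCA mulrC ler_pM2r.
Qed.

(** * Averaging, incidence and the Lagrangian *)

(** With S the root, (S + I)(Su - u) = Au - u = 0, and S + I is invertible. *)
Lemma posdef_sqrt_fix {K : realType} {n : nat} {A : 'M[K]_n} {u : 'cV[K]_n} :
  posdef A -> A *m u = u -> psd_sqrt A *m u = u.
Proof.
move=> Apd Au; have Spd := posdef_sqrt Apd.
have [_ SS] := psd_sqrtP (posdef_possemidef Apd).
have SIu := posdef_unit (posdefDl Spd (posdef_possemidef posdef1)).
apply/eqP; rewrite -subr_eq0 -[_ - _](mulKmx SIu).
rewrite mulmxDl mul1mx mulmxBr mulmxA SS Au addrA subrK subrr.
by rewrite mulmx0.
Qed.

Lemma invmx_fix {K : realType} {n : nat} {A : 'M[K]_n} {u : 'cV[K]_n} :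
  A \in unitmx -> A *m u = u -> invmx A *m u = u.
Proof. by move=> Aunit {1}<-; rewrite mulKmx. Qed.

Lemma dual_argmin_fix {K : realType} {n : nat} {Qp Y : 'M[K]_n} {u : 'cV[K]_n} :
  posdef Qp -> posdef Y -> Qp *m u = u -> Y *m u = u ->
  dual_argmin Qp Y *m u = u.
Proof.
move=> Qpd Ypd Qu Yu; have Su := posdef_sqrt_fix Qpd Qu.
have SYSpd := posdef_sandwich (posdef_sqrt Qpd) Ypd.
have Tu : psd_sqrt (psd_sqrt Qp *m Y *m psd_sqrt Qp) *m u = u.
  by apply: posdef_sqrt_fix => //; rewrite -!mulmxA Su Yu Su.
rewrite /dual_argmin -mulmxA Su -mulmxA (invmx_fix _ Tu) ?Su //.
exact/posdef_unit/posdef_sqrt.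
Qed.

Lemma posdef_mxtrace_gt0 {K : realType} {n : nat} {A : 'M[K]_n} :
  (0 < n)%N -> posdef A -> 0 < \tr A.
Proof.
move=> n0 Apd; pose i := Ordinal n0.
have v0 : (delta_mx i 0 : 'cV[K]_n) != 0.
  by apply/eqP => /colP/(_ i)/eqP; rewrite !mxE !eqxx oner_eq0.
have := lt_le_trans (Apd.2 _ v0)
  (possemidef_quad_le_trace (delta_mx i 0) (posdef_possemidef Apd)).
by rewrite pmulr_lgt0 // dotvv_gt0.
Qed.

Lemma trmx_avg_mx {K : realType} {n : nat} : (avg_mx : 'M[K]_n)^T = avg_mx.
Proof. by rewrite /avg_mx linearZ /= trmx_mul trmxK. Qed.

Lemma avg_mx_ones {K : realType} {n : nat} :
  (0 < n)%N -> (avg_mx : 'M[K]_n) *m ones = ones.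
Proof.
move=> n0; rewrite /avg_mx -scalemxAl -mulmxA.
have -> : (ones : 'cV[K]_n)^T *m ones = n%:R%:M.
  apply/matrixP => i j; rewrite !ord1 !mxE eqxx mulr1n.
  under eq_bigr => k _ do rewrite !mxE mulr1.
  by rewrite sumr_const card_ord.
by rewrite mul_mx_scalar scalerA mulVf ?scale1r // pnatr_eq0 -lt0n.
Qed.

Lemma avg_mx_possemidef {K : realType} {n : nat} : possemidef (avg_mx : 'M[K]_n).
Proof.
by apply: possemidefZ; [rewrite invr_ge0 ler0n | exact: rank1_possemidef].
Qed.

Lemma incidence_ones {K : realType} {n m : nat} {E : 'M[K]_(n, m)} :
  is_incidence E -> E^T *m ones = 0.
Proof.
move=> Einc; apply/colP => j; have [i [k [ik Ei Ek E0]]] := Einc j.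
rewrite !mxE (bigD1 i) //= (bigD1 k) /=; last by rewrite eq_sym.
rewrite !mxE Ei Ek !mulr1 big1 ?addr0 ?subrr // => l /andP[li lk].
by rewrite !mxE E0 // mul0r.
Qed.

Lemma mx_norm_le {K : realType} {m : nat} (d : 'cV[K]_m) (g : K) : 0 <= g ->
  mx_norm d <= g <-> forall i, `|d i 0| <= g.
Proof.
move=> g0; rewrite mx_normrE; split=> [dg i|dg].
  apply: le_trans dg.
  exact: (le_bigmax_cond _ (fun ij : 'I_m * 'I_1 => `|d ij.1 ij.2|)
            (isT : xpredT (i, 0))).
by apply: bigmax_le => // -[i j] _ /=; rewrite ord1.
Qed.

Lemma mx_norm_le_nonneg {K : realType} {m : nat} (d : 'cV[K]_m) (g : K) :
  0 <= g -> mx_norm d <= g <->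
  nonneg_vec (g *: ones - d) /\ nonneg_vec (g *: ones + d).
Proof.
move=> g0; rewrite mx_norm_le //; split=> [dg|[dp dn] i].
  by split=> i; have := dg i; rewrite !mxE mulr1 ler_norml; lra.
by have := dp i; have := dn i; rewrite !mxE mulr1 ler_norml; lra.
Qed.

Lemma mxtrace_mul_diag_mx {K : realType} {m : nat} (A : 'M[K]_m) (x : 'cV[K]_m) :
  \tr (A *m diag_mx x^T) = dotv (diagv A) x.
Proof.
rewrite /dotv mxE; apply: eq_bigr => i _; rewrite mul_mx_diag !mxE //.
Qed.

Lemma dotvDl {K : realType} {m : nat} (x y z : 'cV[K]_m) :
  dotv (x + y) z = dotv x z + dotv y z.
Proof. by rewrite /dotv linearD /= mulmxDl mxE. Qed.

Lemma dotvNl {K : realType} {m : nat} (x z : 'cV[K]_m) :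
  dotv (- x) z = - dotv x z.
Proof. by rewrite /dotv linearN /= mulNmx mxE. Qed.

Lemma dotvNr {K : realType} {m : nat} (x z : 'cV[K]_m) :
  dotv x (- z) = - dotv x z.
Proof. by rewrite dotvC dotvNl dotvC. Qed.

Lemma dotvDr {K : realType} {m : nat} (x y z : 'cV[K]_m) :
  dotv x (y + z) = dotv x y + dotv x z.
Proof. by rewrite dotvC dotvDl !(dotvC x). Qed.

Lemma dotvZr {K : realType} {m : nat} (a : K) (x z : 'cV[K]_m) :
  dotv x (a *: z) = a * dotv x z.
Proof. by rewrite /dotv -scalemxAr mxE. Qed.

Lemma dotv_ones {K : realType} {m : nat} (x y : 'cV[K]_m) :
  dotv ones (hadamard x y) = dotv x y.
Proof.
by rewrite /dotv !mxE; apply: eq_bigr => i _; rewrite !mxE mul1r.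
Qed.

Lemma diagvD {K : realType} {m : nat} (A B : 'M[K]_m) :
  diagv (A + B) = diagv A + diagv B.
Proof. by apply/colP => i; rewrite !mxE. Qed.

Lemma diagvN {K : realType} {m : nat} (A : 'M[K]_m) : diagv (- A) = - diagv A.
Proof. by apply/colP => i; rewrite !mxE. Qed.

Lemma diagv_congruenceB {K : realType} {n m : nat} (E : 'M[K]_(n, m))
    (Y R : 'M[K]_n) :
  diagv (E^T *m (Y - R) *m E) = diagv (E^T *m Y *m E) - diagv (E^T *m R *m E).
Proof. by rewrite mulmxBr mulmxBl diagvD diagvN. Qed.

(** Cyclicity turns the edge part of the residual term into the pairing of diag(E^T Y E) with
    [xp - xn]. The Lagrangian is therefore linear in [xp] and [xn] apart from the reduced part, with
    slopes equal to the mismatch of the multipliers. *)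
Lemma lagrangianE {K : realType} {n m : nat} (Qp Gp : 'M[K]_n)
    (E : 'M[K]_(n, m)) (R : 'M[K]_n) (gamma : K) (Y : 'M[K]_n)
    (yp yn : 'cV[K]_m) (G : 'M[K]_n) (xp xn : 'cV[K]_m) :
  Y^T = Y -> G^T = G ->
  lagrangian Qp Gp E (diagv (E^T *m R *m E)) gamma Y yp yn G xp xn
  = reduced_lagrangian Qp Gp Y G
    + dotv (ypos E R gamma Y - yp) xp + dotv (yneg E R gamma Y - yn) xn.
Proof.
move=> Ys Gs; rewrite /lagrangian /primal_obj /primal_residual /dotm.
rewrite (trmx_invmx_sym Gs) Ys (mulmxBr Y) [\tr (_ - _)]linearB /=.
have -> : \tr (Y *m (E *m diag_mx (xp - xn)^T *m E^T))
  = dotv (diagv (E^T *m Y *m E)) (xp - xn).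
  by rewrite -mxtrace_mul_diag_mx mulmxA mxtrace_mulC !mulmxA.
rewrite /reduced_lagrangian /ypos /yneg diagv_congruenceB.
rewrite !(dotvDl, dotvDr, dotvNl, dotvNr); ring.
Qed.

(** * Convex combinations and balancing of multipliers *)

Lemma reduced_lagrangian_mix {K : realType} {n : nat} (Qp Gp Y Z G : 'M[K]_n)
    (e : K) :
  reduced_lagrangian Qp Gp ((1 - e) *: Y + e *: Z) G
  = (1 - e) * reduced_lagrangian Qp Gp Y G + e * reduced_lagrangian Qp Gp Z G.
Proof.
rewrite /reduced_lagrangian mulmxDl linearD /= -!scalemxAl !mxtraceZ; ring.
Qed.

Lemma ypos_mix {K : realType} {n m : nat} (E : 'M[K]_(n, m)) (R : 'M[K]_n)
    (gamma : K) (Y Z : 'M[K]_n) (e : K) :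
  ypos E R gamma ((1 - e) *: Y + e *: Z)
  = (1 - e) *: ypos E R gamma Y + e *: ypos E R gamma Z.
Proof.
rewrite /ypos !diagv_congruenceB mulmxDr mulmxDl -!scalemxAr -!scalemxAl.
by apply/colP => i; rewrite !mxE; ring.
Qed.

Lemma yneg_mix {K : realType} {n m : nat} (E : 'M[K]_(n, m)) (R : 'M[K]_n)
    (gamma : K) (Y Z : 'M[K]_n) (e : K) :
  yneg E R gamma ((1 - e) *: Y + e *: Z)
  = (1 - e) *: yneg E R gamma Y + e *: yneg E R gamma Z.
Proof.
rewrite /yneg !diagv_congruenceB mulmxDr mulmxDl -!scalemxAr -!scalemxAl.
by apply/colP => i; rewrite !mxE; ring.
Qed.

Lemma nonneg_vec_mix {K : realType} {m : nat} (x y : 'cV[K]_m) (e : K) :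
  0 <= e <= 1 -> nonneg_vec x -> nonneg_vec y ->
  nonneg_vec ((1 - e) *: x + e *: y).
Proof.
move=> /andP[e0 e1] x0 y0 i; rewrite !mxE addr_ge0 // mulr_ge0 //.
by rewrite subr_ge0.
Qed.

(* The edge constraints cannot tell balance Y from Y because E^T 1 = 0. *)
Definition balance {K : realType} {n : nat} (Y : 'M[K]_n) : 'M[K]_n :=
  (1%:M - avg_mx)^T *m Y *m (1%:M - avg_mx) + avg_mx.

Lemma balance_ones {K : realType} {n : nat} (Y : 'M[K]_n) :
  (0 < n)%N -> balance Y *m ones = ones.
Proof.
move=> n0; rewrite mulmxDl -mulmxA mulmxBl mul1mx avg_mx_ones // subrr mulmx0.
by rewrite add0r.
Qed.

Lemma posdef_balance {K : realType} {n : nat} {Y : 'M[K]_n} :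
  (0 < n)%N -> posdef Y -> posdef (balance Y).
Proof.
move=> n0 Ypd; split=> [|v v0].
  by rewrite linearD /= trmx_avg_mx (mulmx_trmx_sym _ _ (proj1 Ypd)).
rewrite mulmxDr mulmxDl mxE !mulmxA -trmx_mul -mulmxA.
(* If the centred part of [v] vanishes, the averaging term alone contributes |v|^2; otherwise the
   congruence term is already positive. *)
have [Pv|Pv] := eqVneq ((1%:M - avg_mx) *m v) 0.
  rewrite Pv mulmx0 mxE add0r.
  have -> : v^T *m avg_mx *m v = v^T *m v.
    by move/eqP: Pv; rewrite mulmxBl mul1mx subr_eq0 -mulmxA => /eqP <-.
  exact: dotvv_gt0.
by rewrite ltr_pwDl //; [exact: Ypd.2 | exact: avg_mx_possemidef.2].
Qed.

Lemma edge_balance {K : realType} {n m : nat} {E : 'M[K]_(n, m)} (Y : 'M[K]_n) :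
  E^T *m ones = 0 -> E^T *m balance Y *m E = E^T *m Y *m E.
Proof.
move=> E1; have Ea : E^T *m avg_mx = 0.
  by rewrite /avg_mx -scalemxAr mulmxA E1 mul0mx scaler0.
have aE : avg_mx *m E = 0.
  by rewrite -[LHS]trmxK trmx_mul trmx_avg_mx Ea trmx0.
rewrite /balance mulmxDr mulmxDl Ea mul0mx addr0 !mulmxA.
rewrite [(_ - _)^T]linearB /= trmx1.
rewrite trmx_avg_mx (mulmxBr E^T) Ea mulmx1 subr0 -mulmxA mulmxBl mul1mx aE subr0.
by [].
Qed.

Lemma ypos_balance {K : realType} {n m : nat} {E : 'M[K]_(n, m)}
    (R : 'M[K]_n) (gamma : K) (Y : 'M[K]_n) :
  E^T *m ones = 0 -> ypos E R gamma (balance Y) = ypos E R gamma Y.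
Proof. by move=> E1; rewrite /ypos !diagv_congruenceB edge_balance. Qed.

Lemma yneg_balance {K : realType} {n m : nat} {E : 'M[K]_(n, m)}
    (R : 'M[K]_n) (gamma : K) (Y : 'M[K]_n) :
  E^T *m ones = 0 -> yneg E R gamma (balance Y) = yneg E R gamma Y.
Proof. by move=> E1; rewrite /yneg !diagv_congruenceB edge_balance. Qed.

(** [G - Gp] is symmetric and annihilates [ones], so the projections act on it as the identity and
    its trace against [avg_mx] vanishes. *)
Lemma reduced_lagrangian_balance {K : realType} {n : nat}
    (Qp : 'M[K]_n) {Gp Y G : 'M[K]_n} :
  G^T = G -> G *m ones = ones -> Gp^T = Gp -> Gp *m ones = ones ->
  reduced_lagrangian Qp Gp (balance Y) G = reduced_lagrangian Qp Gp Y G.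
Proof.
move=> Gs G1 Gps Gp1; rewrite /reduced_lagrangian; congr (_ + _).
have Da : (G - Gp) *m avg_mx = 0.
  by rewrite /avg_mx -scalemxAr mulmxA mulmxBl G1 Gp1 subrr mul0mx scaler0.
have aD : avg_mx *m (G - Gp) = 0.
  by rewrite -[LHS]trmxK trmx_mul trmx_avg_mx linearB /= Gs Gps Da trmx0.
rewrite /balance mulmxDl aD addr0 -!mulmxA mulmxBl mul1mx aD subr0.
rewrite mxtrace_mulC [(_ - _)^T]linearB /= trmx1 trmx_avg_mx.
by rewrite -mulmxA mulmxBr mulmx1 Da subr0.
Qed.

Lemma dual_feasibleP {K : realType} {n m : nat} (E : 'M[K]_(n, m))
    (R : 'M[K]_n) (gamma : K) (Y : 'M[K]_n) : 0 <= gamma ->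
  dual_feasible E R gamma Y <->
  [/\ nonneg_vec (ypos E R gamma Y), nonneg_vec (yneg E R gamma Y),
      posdef Y & Y *m ones = ones].
Proof.
move=> g0; rewrite /ypos /yneg; split.
  by case=> /(mx_norm_le_nonneg _ _ g0)[].
by case=> ? ? ? ?; split=> //; apply/(mx_norm_le_nonneg _ _ g0).
Qed.

(** * The Lagrange dual *)

Section DualProblem.
Context {K : realType} {n m : nat} {Qp Gp R : 'M[K]_n} {E : 'M[K]_(n, m)}
  {gamma : K}.
Hypotheses (n_gt0 : (0 < n)%N) (gamma_ge0 : 0 <= gamma).
Hypotheses (Qp_pd : posdef Qp) (Qp1 : Qp *m ones = ones).
Hypotheses (Gp_sym : Gp^T = Gp) (Gp1 : Gp *m ones = ones).
Hypotheses (R_pd : posdef R) (E1 : E^T *m ones = 0).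

Local Notation c := (diagv (E^T *m R *m E)).
Local Notation yp_ := (ypos E R gamma).
Local Notation yn_ := (yneg E R gamma).
Local Notation phi := (reduced_lagrangian Qp Gp).
Local Notation dual_fun := (lagrange_dual_fun Qp Gp E c gamma).

Lemma lagrangian_reduced (Y G : 'M[K]_n) (xp xn : 'cV[K]_m) :
  Y^T = Y -> posdef G ->
  lagrangian Qp Gp E c gamma Y (yp_ Y) (yn_ Y) G xp xn = phi Y G.
Proof.
move=> Ys Gpd; rewrite lagrangianE ?(proj1 Gpd) // !subrr /dotv.
by rewrite trmx0 !mul0mx !mxE !addr0.
Qed.

Lemma le_lagrange_dual_fun (Y : 'M[K]_n) (l : K) : Y^T = Y ->
  (l%:E <= dual_fun Y (yp_ Y) (yn_ Y))%E <->
  forall G, posdef G -> l <= phi Y G.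
Proof.
move=> Ys; split=> [lg G Gpd|lb].
  rewrite -lee_fin; apply: (le_trans lg); apply: ereal_inf_lbound.
  by exists G, 0, 0; split=> //; rewrite lagrangian_reduced.
apply: le_ereal_inf_tmp => _ [G [xp [xn [Gpd ->]]]].
by rewrite lagrangian_reduced // lee_fin; exact: lb.
Qed.

(** The value of the Lagrangian at G = I bounds the infimum above, so only -oo has to be
    excluded. *)
Lemma lagrange_dual_fun_finite {Y : 'M[K]_n} {yp yn : 'cV[K]_m} :
  (-oo < dual_fun Y yp yn)%E -> exists l : K, dual_fun Y yp yn = l%:E.
Proof.
move=> g_gt; have : (dual_fun Y yp yn < +oo)%E.
  apply: le_lt_trans (ltry (lagrangian Qp Gp E c gamma Y yp yn 1%:M 0 0)).
  by apply: ereal_inf_lbound; exists 1%:M, 0, 0; split=> //; exact: posdef1.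
by case: (dual_fun Y yp yn) g_gt => // l _ _; exists l.
Qed.

(** At G = I the Lagrangian is affine in [xp] and [xn]. Moving both against their slopes [dp] and
    [dn] decreases it without bound unless the slopes are zero. *)
Lemma lagrange_dual_fun_multipliers {Y : 'M[K]_n} {yp yn : 'cV[K]_m} :
  Y^T = Y -> (-oo < dual_fun Y yp yn)%E -> yp = yp_ Y /\ yn = yn_ Y.
Proof.
move=> Ys /lagrange_dual_fun_finite[l gl].
pose dp := yp_ Y - yp; pose dn := yn_ Y - yn.
pose r := phi Y 1%:M; pose d := dotv dp dp + dotv dn dn.
have lb t : l <= r - t * d.
  rewrite -lee_fin -gl; apply: ereal_inf_lbound.
  exists 1%:M, (- t *: dp), (- t *: dn); split; first exact: posdef1.
  rewrite lagrangianE ?trmx1 // !dotvZr -/dp -/dn /d; congr (_%:E).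
  by rewrite /r; ring.
have [dp0 dn0] : dotv dp dp = 0 /\ dotv dn dn = 0.
  have dp_ge := dotvv_ge0 dp; have dn_ge := dotvv_ge0 dn.
  have [d0|d0] := eqVneq d 0; first by move: d0; rewrite /d; lra.
  (* This step length brings the Lagrangian down to [l - 1], below its infimum. *)
  have := lb ((r - l + 1) / d); rewrite divfK //; lra.
split; apply/esym/eqP; rewrite -subr_eq0; apply/eqP.
  by apply/eqP; rewrite -dotvv_eq0 dp0.
by apply/eqP; rewrite -dotvv_eq0 dn0.
Qed.

Lemma lagrange_dual_fun_dual_obj {Y : 'M[K]_n} : posdef Y ->
  dual_fun Y (yp_ Y) (yn_ Y) = (dual_obj Qp Gp Y)%:E.
Proof.
move=> Ypd; have Hpd := posdef_dual_argmin Qp_pd Ypd.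
apply/eqP; rewrite eq_le; apply/andP; split.
  apply: ereal_inf_lbound; exists (dual_argmin Qp Y), 0, 0; split=> //.
  by rewrite lagrangian_reduced ?(proj1 Ypd) // reduced_lagrangian_argmin.
apply/le_lagrange_dual_fun; first exact: proj1 Ypd.
by move=> G Gpd; exact: dual_obj_le_reduced_lagrangian.
Qed.

Lemma lagrangian_minimizer_bounded {Y G : 'M[K]_n} {yp yn xp xn : 'cV[K]_m} :
  lagrangian_minimizer Qp Gp E c gamma Y yp yn G xp xn ->
  (-oo < dual_fun Y yp yn)%E.
Proof.
move=> [Gpd Gmin].
apply: (lt_le_trans (ltNyr (lagrangian Qp Gp E c gamma Y yp yn G xp xn))).
apply: le_ereal_inf_tmp => _ [G' [xp' [xn' [Gpd' ->]]]].
by rewrite lee_fin; exact: Gmin.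
Qed.

Lemma lagrangian_minimizer_reduced (Y G : 'M[K]_n) (xp xn : 'cV[K]_m) :
  Y^T = Y ->
  lagrangian_minimizer Qp Gp E c gamma Y (yp_ Y) (yn_ Y) G xp xn <->
  posdef G /\ forall G', posdef G' -> phi Y G <= phi Y G'.
Proof.
move=> Ys; split=> -[Gpd Gmin]; split=> //.
  by move=> G' Gpd'; have := Gmin G' 0 0 Gpd'; rewrite !lagrangian_reduced.
by move=> G' xp' xn' Gpd'; rewrite !lagrangian_reduced //; exact: Gmin.
Qed.

(** * Feasible points of (D) obtained from arbitrary multipliers *)

Lemma balance_feasible {Y : 'M[K]_n} :
  posdef Y -> nonneg_vec (yp_ Y) -> nonneg_vec (yn_ Y) ->
  dual_feasible E R gamma (balance Y).
Proof.
move=> Ypd yp0 yn0; apply/dual_feasibleP => //.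
rewrite ypos_balance // yneg_balance //; split=> //.
  exact: posdef_balance.
exact: balance_ones.
Qed.

(* R makes the edge constraints inactive, so its balanced version is a Slater
   point of (D). *)
Lemma multipliers_weight : yp_ R = gamma *: ones /\ yn_ R = gamma *: ones.
Proof.
have d0 : diagv (E^T *m (R - R) *m E) = 0.
  by apply/colP => i; rewrite subrr mulmx0 mul0mx !mxE.
by rewrite /ypos /yneg d0 subr0 addr0.
Qed.

Lemma nonneg_multipliers_weight : nonneg_vec (yp_ R) /\ nonneg_vec (yn_ R).
Proof.
have [-> ->] := multipliers_weight.
by split=> i; rewrite !mxE mulr1.
Qed.

(* Since the minimizer G for the balanced multiplier satisfies G 1 = 1, balancing
   Y does not change its reduced Lagrangian at G. *)
Lemma balance_dual_obj {Y : 'M[K]_n} : posdef Y ->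
  exists2 G, posdef G /\ G *m ones = ones & dual_obj Qp Gp (balance Y) = phi Y G.
Proof.
move=> Ypd; have Zpd := posdef_balance n_gt0 Ypd.
have Z1 := balance_ones Y n_gt0.
exists (dual_argmin Qp (balance Y)).
  by split; [exact: posdef_dual_argmin | exact: dual_argmin_fix].
rewrite -(reduced_lagrangian_argmin Qp_pd Zpd) reduced_lagrangian_balance //.
  exact: (posdef_dual_argmin Qp_pd Zpd).1.
exact: dual_argmin_fix.
Qed.

(** Mixing with [R] gives positive definiteness, convexity keeps the edge constraints, and balancing
    gives [Z *m ones = ones]. The objective then splits because the reduced Lagrangian is affine in
    the multiplier. *)
Lemma dual_feasible_perturbation {Y : 'M[K]_n} {e : K} :
  possemidef Y -> nonneg_vec (yp_ Y) -> nonneg_vec (yn_ Y) -> 0 < e <= 1 ->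
  exists Z G, [/\ dual_feasible E R gamma Z, posdef G &
    dual_obj Qp Gp Z = (1 - e) * phi Y G + e * phi R G].
Proof.
move=> Ypsd yp0 yn0 /andP[e0 e1].
have e01 : 0 <= e <= 1 by rewrite (ltW e0) e1.
have Zpd : posdef ((1 - e) *: Y + e *: R).
  rewrite addrC; apply: posdefDl (posdefZ e0 R_pd) (possemidefZ _ Ypsd).
  by rewrite subr_ge0.
have [rp0 rn0] := nonneg_multipliers_weight.
have [G [Gpd _] Zobj] := balance_dual_obj Zpd.
exists (balance ((1 - e) *: Y + e *: R)), G.
rewrite Zobj reduced_lagrangian_mix; split=> //.
apply: balance_feasible => //.
  by rewrite ypos_mix; exact: nonneg_vec_mix.
by rewrite yneg_mix; exact: nonneg_vec_mix.
Qed.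

(** R - rI is positive semidefinite for some r > 0, and the [Qp] term is nonnegative. This later
    controls the trace of minimizers. *)
Lemma reduced_lagrangian_weight_coercive :
  exists2 r, 0 < r & exists C, forall G, posdef G -> r * \tr G - C <= phi R G.
Proof.
have [r r0 Rr] := posdef_coercive R_pd.
exists r => //; exists (\tr (R *m Gp)) => G Gpd.
have RrI : possemidef (R - r *: 1%:M).
  split=> [|v]; first by rewrite linearB linearZ /= trmx1 (proj1 R_pd).
  rewrite mulmxBr mulmxBl -scalemxAr mulmx1 -scalemxAl !mxE subr_ge0.
  by have := Rr v; rewrite /dotv !mxE.
have := mxtrace_mul_ge0 RrI (posdef_possemidef Gpd).
have := mxtrace_mul_ge0 (posdef_possemidef (posdef_inv Gpd))
                        (posdef_possemidef Qp_pd).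
rewrite /reduced_lagrangian mulmxBr mulmxBl -scalemxAl mul1mx.
by rewrite !linearB /= mxtraceZ; lra.
Qed.

Lemma dual_bound_le {Y : 'M[K]_n} {l d : K} :
  possemidef Y -> nonneg_vec (yp_ Y) -> nonneg_vec (yn_ Y) ->
  (forall G, posdef G -> l <= phi Y G) ->
  (forall Z, dual_feasible E R gamma Z -> dual_obj Qp Gp Z <= d) -> l <= d.
Proof.
move=> Ypsd yp0 yn0 lb ub; rewrite leNgt; apply/negP => dl.
pose r := dual_obj Qp Gp R.
(* This weight makes [e * |l - r|] smaller than [l - d], so the perturbed objective, at least (1 -
   e) l + e r, exceeds [d]. *)
pose e := (l - d) / (l - d + `|l - r| + 1).
have a0 := normr_ge0 (l - r).
have e0 : 0 < e by rewrite divr_gt0 ?subr_gt0 //; lra.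
have e1 : e <= 1 by rewrite ler_pdivrMr ?mul1r; lra.
have [|Z [G [Zf Gpd Zobj]]] := dual_feasible_perturbation Ypsd yp0 yn0 (e := e).
  by rewrite e0.
have := ub _ Zf; rewrite Zobj => Zd.
have lY := lb _ Gpd.
have rR : r <= phi R G by exact: dual_obj_le_reduced_lagrangian.
have e1' : 0 <= 1 - e by rewrite subr_ge0.
have h1 : (1 - e) * l <= (1 - e) * phi Y G by rewrite ler_wpM2l.
have h2 : e * r <= e * phi R G by rewrite ler_wpM2l // ltW.
have h3 : e * (l - r) <= e * `|l - r| by rewrite ler_wpM2l ?ler_norm // ltW.
have : e * (l - d + `|l - r| + 1) = l - d by rewrite divfK // gt_eqF //; lra.
have : 0 < e * (l - d) by rewrite mulr_gt0 // subr_gt0.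
lra.
Qed.

(* Moving a singular Y by e towards R raises the dual function by an amount of
   order sqrt e, which beats the loss of order e. *)
Lemma dual_bound_attained_posdef {Y : 'M[K]_n} {l : K} :
  possemidef Y -> nonneg_vec (yp_ Y) -> nonneg_vec (yn_ Y) ->
  (forall G, posdef G -> l <= phi Y G) ->
  (forall Z, dual_feasible E R gamma Z -> dual_obj Qp Gp Z <= l) -> posdef Y.
Proof.
move=> Ypsd yp0 yn0 lb ub; split=> [|v v0]; first exact: proj1 Ypsd.
rewrite lt_neqAle (proj2 Ypsd) andbT; apply/negP => /eqP/esym Yv.
have [q q0 Qq] := posdef_coercive Qp_pd.
have [r r0 [C RC]] := reduced_lagrangian_weight_coercive.
pose b := `|l + C| + 1.
have b0 : 0 < b by rewrite ltr_wpDl.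
have qr0 : 0 < q * r by rewrite mulr_gt0.
have b2 : 0 < b * b by rewrite mulr_gt0.
(* The summand [2 * (q * r)] gives e <= 1/2. The summand [8 * (b * b)] makes 4 e b^2 < q r, whereas
   the estimates below yield q r <= 4 e b^2. *)
pose e := q * r / (8 * (b * b) + 2 * (q * r)).
have den0 : 0 < 8 * (b * b) + 2 * (q * r) by lra.
have e0 : 0 < e by rewrite divr_gt0.
have e2 : e <= 2^-1 by rewrite ler_pdivrMr //; lra.
have eE : e * (8 * (b * b) + 2 * (q * r)) = q * r by rewrite divfK // gt_eqF.
have [|Z [G [Zf Gpd Zobj]]] := dual_feasible_perturbation Ypsd yp0 yn0 (e := e).
  by rewrite e0 /=; lra.
have := ub _ Zf; rewrite Zobj => Zl.
have [G' G'pd GG'] := reduced_lagrangian_null_descent (Gp := Gp) q0 Qq v0 Yv Gpd.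
have lG := le_trans (lb _ G'pd) GG'.
have RG := RC _ Gpd.
have z0 := posdef_mxtrace_gt0 n_gt0 Gpd.
move: lG RG z0 Zl; set z := \tr G; set a := q / (2 * z).
set pY := phi Y G; set pR := phi R G => lG RG z0 Zl.
have a0 : 0 < a by rewrite divr_gt0 // mulr_gt0.
(* The descent [a] and the trace [z] have a fixed product, so they cannot both be small; [key]
   bounds [z] by b / r and [a] by 2 e b. *)
have az : a * z = q / 2 by rewrite /a; field; rewrite gt_eqF.
have h1 : (1 - e) * (l + a) <= (1 - e) * pY by rewrite ler_wpM2l //; lra.
have h2 : e * (r * z - C) <= e * pR by rewrite ler_wpM2l // ltW.
have h3 : e * (l + C) <= e * b.
  by rewrite ler_wpM2l ?(ltW e0) // (le_trans (ler_norm _)) // lerDl.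
have h4 : e * a <= 2^-1 * a by rewrite ler_wpM2r // ltW.
have key : a / 2 + e * (r * z) <= e * b by lra.
have rz : r * z <= b.
  by rewrite -(ler_pM2l e0) (le_trans _ key) // lerDr divr_ge0 // ltW.
have ab : a / 2 <= e * b.
  apply: le_trans key; rewrite lerDl mulr_ge0 ?(ltW e0) //.
  by rewrite mulr_ge0 // ltW.
have h5 : a * (r * z) <= a * b by rewrite ler_wpM2l // ltW.
have h6 : a / 2 * b <= e * b * b by rewrite ler_wpM2r // ltW.
have h7 : a * (r * z) = q * r / 2 by rewrite mulrCA az; ring.
have h8 : 0 < e * (q * r) by rewrite mulr_gt0.
lra.
Qed.

(* The Riccati equation G Y G = Qp turns G 1 = 1 and Qp 1 = 1 into Y 1 = 1. *)
Lemma argmin_ones_fix {Y G : 'M[K]_n} :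
  posdef Y -> posdef G -> G *m ones = ones -> phi Y G <= dual_obj Qp Gp Y ->
  Y *m ones = ones.
Proof.
move=> Ypd Gpd G1 Gmin.
have GE := reduced_lagrangian_argmin_unique Qp_pd Ypd Gpd Gmin.
have := dual_argmin_riccati Qp_pd Ypd; rewrite -GE => GYG.
have GY1 : G *m (Y *m ones) = ones by rewrite -{1}G1 !mulmxA GYG.
rewrite -(mulKmx (posdef_unit Gpd) (Y *m ones)) GY1.
exact: invmx_fix (posdef_unit Gpd) G1.
Qed.

(** The balanced multiplier is feasible, so its objective, which equals [phi Y G] at some [G] fixing
    [ones], is at most [l]. Hence that [G] minimizes [phi Y], and the Riccati argument applies. *)
Lemma dual_bound_attained_ones {Y : 'M[K]_n} {l : K} :
  posdef Y -> nonneg_vec (yp_ Y) -> nonneg_vec (yn_ Y) ->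
  (forall G, posdef G -> l <= phi Y G) ->
  (forall Z, dual_feasible E R gamma Z -> dual_obj Qp Gp Z <= l) ->
  Y *m ones = ones.
Proof.
move=> Ypd yp0 yn0 lb ub.
have [G [Gpd G1] Zobj] := balance_dual_obj Ypd.
have Zl := ub _ (balance_feasible Ypd yp0 yn0).
have lY := lb _ (posdef_dual_argmin Qp_pd Ypd).
rewrite reduced_lagrangian_argmin // in lY.
rewrite Zobj in Zl.
exact: argmin_ones_fix Ypd Gpd G1 (le_trans Zl lY).
Qed.
End DualProblem.

(** * The Lagrange dual, its optimal solutions and the duality gap *)

Theorem proposition2 (K : realType) (n m : nat)
    (Lp Q R : 'M[K]_n) (E : 'M[K]_(n, m)) (gamma : K)
    (n_gt0 : (0 < n)%N)
    (Lp_sym : Lp^T = Lp) (Lp1 : Lp *m ones = 0)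
    (E_inc : is_incidence E)
    (Q_psd : possemidef Q) (R_pd : posdef R)
    (Q1 : Q *m ones = 0) (Q_avg_pd : posdef (Q + avg_mx))
    (gamma_gt0 : 0 < gamma) :
  let Gp := plant_G Lp in
  let Qp := plant_Q Q R Lp in
  let c := diagv (E^T *m R *m E) in
  (* the Lagrange dual of (P) is (D) *)
  (* multipliers of x+ and x- outside the given form are ruled out, since the
     Lagrangian is then unbounded below *)
  (forall (Y : 'M[K]_n) (yp yn : 'cV[K]_m), Y^T = Y ->
     (-oo < lagrange_dual_fun Qp Gp E c gamma Y yp yn)%E ->
     yp = ypos E R gamma Y /\ yn = yneg E R gamma Y)
  /\
  (* the feasible set of (D): multipliers for which the Lagrangian is minimized
     at a G with G 1 = 1 *)
  (forall (Y : 'M[K]_n) (yp yn : 'cV[K]_m), multipliers_feasible Y yp yn ->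
     ((exists (G : 'M[K]_n) (xp xn : 'cV[K]_m),
         lagrangian_minimizer Qp Gp E c gamma Y yp yn G xp xn
         /\ G *m ones = ones)
      <-> [/\ dual_feasible E R gamma Y,
              yp = ypos E R gamma Y & yn = yneg E R gamma Y]))
  /\
  (* the objective of (D) *)
  (forall Y : 'M[K]_n, dual_feasible E R gamma Y ->
     lagrange_dual_fun Qp Gp E c gamma Y (ypos E R gamma Y) (yneg E R gamma Y)
     = (dual_obj Qp Gp Y)%:E)
  /\
  (* same optimal value and same optimal solutions *)
  lagrange_dual_value Qp Gp E c gamma = dual_value Qp Gp E R gamma
  /\
  (forall (Y : 'M[K]_n) (yp yn : 'cV[K]_m),
     lagrange_dual_optimal Qp Gp E c gamma Y yp yn
     <-> [/\ dual_optimal Qp Gp E R gamma Y,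
             yp = ypos E R gamma Y & yn = yneg E R gamma Y])
  /\
  (* the duality gap *)
  (forall (G : 'M[K]_n) (xp xn : 'cV[K]_m) (Y : 'M[K]_n),
     primal_feasible Gp E G xp xn -> dual_feasible E R gamma Y ->
     let yp := ypos E R gamma Y in
     let yn := yneg E R gamma Y in
     let eta := duality_gap Qp Gp c gamma G xp xn Y in
     [/\ nonneg_vec yp, nonneg_vec yn,
         dotv yp xp + dotv yn xn
         = dotv ones (hadamard yp xp + hadamard yn xn),
         dotv yp xp + dotv yn xn <= eta &
         (lagrangian_minimizer Qp Gp E c gamma Y yp yn G xp xn
          <-> eta = dotv yp xp + dotv yn xn)]).
Proof.
move=> Gp Qp c; have g0 := ltW gamma_gt0.
have Qp_pd : posdef Qp.
  apply: posdefDl Q_avg_pd _; rewrite -{1}Lp_sym.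
  exact/possemidef_congruence/posdef_possemidef.
have Qp1 : Qp *m ones = ones.
  by rewrite /Qp /plant_Q !mulmxDl -mulmxA Lp1 mulmx0 Q1 add0r addr0 avg_mx_ones.
have Gp_sym : Gp^T = Gp by rewrite /Gp /plant_G linearD /= Lp_sym trmx_avg_mx.
have Gp1 : Gp *m ones = ones.
  by rewrite /Gp /plant_G mulmxDl Lp1 add0r avg_mx_ones.
have E1 := incidence_ones E_inc.
have feasP := dual_feasibleP E R gamma _ g0.
have multE := @lagrange_dual_fun_multipliers K n m Qp Gp R E gamma.
have funE Y : dual_feasible E R gamma Y ->
    lagrange_dual_fun Qp Gp E c gamma Y (ypos E R gamma Y) (yneg E R gamma Y)
    = (dual_obj Qp Gp Y)%:E.
  by case=> _ Ypd _; exact: lagrange_dual_fun_dual_obj.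
have feas_mult Y : dual_feasible E R gamma Y ->
    multipliers_feasible Y (ypos E R gamma Y) (yneg E R gamma Y).
  by move=> /feasP[yp0 yn0 [Ys _] _].
have slater : dual_feasible E R gamma (balance R).
  have [rp0 rn0] := nonneg_multipliers_weight g0 (R := R) (E := E).
  exact: balance_feasible.
have valueE : lagrange_dual_value Qp Gp E c gamma = dual_value Qp Gp E R gamma.
  apply/eqP; rewrite eq_le; apply/andP; split; last first.
    apply: ge_ereal_sup => _ [Y [Yf ->]]; apply: ereal_sup_ubound.
    exists Y, (ypos E R gamma Y), (yneg E R gamma Y).
    by rewrite funE //; split=> //; exact: feas_mult.
  apply: ge_ereal_sup => _ [Y [yp [yn [[Ys yp0 yn0] ->]]]].
  have [->|gN] := eqVneq (lagrange_dual_fun Qp Gp E c gamma Y yp yn) -oo%E.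
    exact: leNye.
  have g_gt : (-oo < lagrange_dual_fun Qp Gp E c gamma Y yp yn)%E.
    by rewrite ltNye.
  have [l gl] := lagrange_dual_fun_finite g_gt; rewrite gl.
  have [ypE ynE] := multE _ _ _ Ys g_gt.
  rewrite ypE ynE in gl yp0 yn0.
  have /(le_lagrange_dual_fun _ _ Ys) lb :
      (l%:E <= lagrange_dual_fun Qp Gp E c gamma Y (ypos E R gamma Y)
                 (yneg E R gamma Y))%E by rewrite gl.
  have Ypsd := reduced_lagrangian_bounded_possemidef l
                 (posdef_possemidef Qp_pd) Ys lb.
  have ub Z : dual_feasible E R gamma Z ->
      ((dual_obj Qp Gp Z)%:E <= dual_value Qp Gp E R gamma)%E.
    by move=> Zf; apply: ereal_sup_ubound; exists Z.
  have := ub _ slater.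
  (* The Slater point excludes the value -oo, and +oo makes the bound trivial. *)
  case: (dual_value Qp Gp E R gamma) ub => [d|_ _|_]; last by rewrite leeNy_eq.
    move=> ub _; rewrite lee_fin.
    exact: (dual_bound_le n_gt0 g0 Qp_pd Qp1 Gp_sym Gp1 R_pd E1
              Ypsd yp0 yn0 lb ub).
  exact: leey.
split; first exact: multE.
split.
  move=> Y yp yn [Ys yp0 yn0]; split.
    move=> [G [xp [xn [Gmin G1]]]].
    have g_gt := lagrangian_minimizer_bounded Gmin.
    have [ypE ynE] := multE _ _ _ Ys g_gt; split=> //.
    move: Gmin yp0 yn0; rewrite ypE ynE.
    move=> /(lagrangian_minimizer_reduced _ _ _ _ Ys)[Gpd Gmin] yp0 yn0; apply/feasP.
    have Ypsd := reduced_lagrangian_bounded_possemidef _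
                   (posdef_possemidef Qp_pd) Ys Gmin.
    (* A null vector of [Y] would allow a strict descent from the minimizer [G]. *)
    have Ypd : posdef Y.
      split=> // v v0; rewrite lt_neqAle (proj2 Ypsd) andbT.
      apply/negP => /eqP/esym Yv.
      have [q q0 Qq] := posdef_coercive Qp_pd.
      have [G' G'pd] :=
        reduced_lagrangian_null_descent (Gp := Gp) q0 Qq v0 Yv Gpd.
      rewrite leNgt (lt_le_trans _ (Gmin _ G'pd)) // gtrDl oppr_lt0.
      by rewrite divr_gt0 // mulr_gt0 // posdef_mxtrace_gt0.
    split=> //; apply: (argmin_ones_fix Qp_pd Qp1 Ypd Gpd G1).
    rewrite -(reduced_lagrangian_argmin Qp_pd Ypd); apply: Gmin.
    exact: posdef_dual_argmin.
  move=> [/feasP[_ _ Ypd Y1] -> ->].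
  exists (dual_argmin Qp Y), 0, 0; split; last exact: dual_argmin_fix.
  apply/lagrangian_minimizer_reduced => //; split.
    exact: posdef_dual_argmin.
  move=> G Gpd; rewrite reduced_lagrangian_argmin //.
  exact: dual_obj_le_reduced_lagrangian.
split; first exact: funE.
split; first exact: valueE.
split.
  move=> Y yp yn; split.
    move=> [[Ys yp0 yn0] Yopt].
    have ub' Z : dual_feasible E R gamma Z ->
        ((dual_obj Qp Gp Z)%:E <= lagrange_dual_fun Qp Gp E c gamma Y yp yn)%E.
      by move=> Zf; rewrite -funE //; apply/Yopt/feas_mult.
    (* Optimality against the Slater point keeps the dual function above -oo, which forces the form
       of the multipliers. *)
    have g_gt := lt_le_trans (ltNyr _) (ub' _ slater).
    have [ypE ynE] := multE _ _ _ Ys g_gt; split=> //.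
    have [l gl] := lagrange_dual_fun_finite g_gt.
    rewrite ypE ynE in gl yp0 yn0 ub'.
    have /(le_lagrange_dual_fun _ _ Ys) lb :
        (l%:E <= lagrange_dual_fun Qp Gp E c gamma Y (ypos E R gamma Y)
                   (yneg E R gamma Y))%E by rewrite gl.
    have ub Z : dual_feasible E R gamma Z -> dual_obj Qp Gp Z <= l.
      by move=> /ub'; rewrite gl lee_fin.
    have Ypsd := reduced_lagrangian_bounded_possemidef l
                   (posdef_possemidef Qp_pd) Ys lb.
    have Ypd := dual_bound_attained_posdef n_gt0 g0 Qp_pd Qp1 Gp_sym Gp1 R_pd E1
                  Ypsd yp0 yn0 lb ub.
    have Y1 := dual_bound_attained_ones n_gt0 g0 Qp_pd Qp1 Gp_sym Gp1 E1
                  Ypd yp0 yn0 lb ub.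
    split; first by apply/feasP.
    move=> Z /ub Zl; apply: (le_trans Zl).
    rewrite -(reduced_lagrangian_argmin Qp_pd Ypd); apply: lb.
    exact: posdef_dual_argmin.
  move=> [[Yf Yopt] -> ->]; split; first exact: feas_mult.
  move=> Y' yp' yn' Yf'; rewrite funE //.
  (* A competitor [Y'] need not be feasible for (D), so the comparison passes through the common
     optimal value. *)
  apply: (@le_trans _ _ (lagrange_dual_value Qp Gp E c gamma)).
    by apply: ereal_sup_ubound; exists Y', yp', yn'.
  rewrite valueE; apply: ge_ereal_sup => _ [Z [Zf ->]].
  by rewrite lee_fin; exact: Yopt.
move=> G xp xn Y [res0 Gpd xp0 xn0] Yf yp yn eta.
have [yp0 yn0 Ypd Y1] := (feasP Y).1 Yf.
have Ys := proj1 Ypd.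
(* At a primal feasible point the residual vanishes, so the primal objective is the Lagrangian plus
   the complementarity terms. The excess of [eta] over those terms is the suboptimality of [G] for
   the reduced Lagrangian. *)
have etaE : eta = reduced_lagrangian Qp Gp Y G - dual_obj Qp Gp Y
                  + (dotv yp xp + dotv yn xn).
  rewrite -(lagrangian_reduced (E := E) (R := R) (gamma := gamma) Y G xp xn Ys Gpd).
  rewrite /lagrangian res0 /dotm mulmx0 mxtrace0.
  by rewrite /eta /duality_gap /yp /yn; ring.
have gap_ge0 : dual_obj Qp Gp Y <= reduced_lagrangian Qp Gp Y G.
  exact: dual_obj_le_reduced_lagrangian.
split=> //; first by rewrite dotvDr !dotv_ones.
  by rewrite etaE lerDr subr_ge0.
split=> [/(lagrangian_minimizer_reduced _ _ _ _ Ys)[_ Gmin]|].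
  have := Gmin _ (posdef_dual_argmin Qp_pd Ypd).
  rewrite reduced_lagrangian_argmin // etaE => ge; apply/eqP.
  by rewrite -subr_eq0 addrK subr_eq0 eq_le ge gap_ge0.
rewrite etaE => /eqP; rewrite -subr_eq0 addrK subr_eq0 => /eqP GE.
apply/(lagrangian_minimizer_reduced _ _ _ _ Ys); split=> // G' Gpd'.
by rewrite GE; exact: dual_obj_le_reduced_lagrangian.
Qed.
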